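(* For every integer $n\ge 3$, the price of PROP1 with respect to egalitarian welfare for allocating contiguous blocks of goods to $n$ agents is infinite: $\mathrm{PoF}_n=\infty$.
   Context: A fair-goods instance $\mathcal I=\langle N,E,\mathcal V\rangle$ consists of agents $N=\{1,\dots,n\}$, indivisible items $E=\{e_1,\dots,e_m\}$ placed on a path in this order, and for each agent $i$ an additive valuation $v_i$ (i.e. $v_i(S)=\sum_{e\in S}v_i(e)$) with $v_i(e)\ge 0$ for all $e\in E$, normalized so that $v_i(\emptyset)=0$, $v_i(E)=1$. A bundle is connected if it is a set of consecutive items (the empty set is allowed). An allocation $\mathbf A=(A_1,\dots,A_n)$ is a partition of $E$ into $n$ pairwise disjoint connected (possibly empty) bundles, $A_i$ being given to agent $i$ (the left-to-right order of the agents' bundles is arbitrary). Its egalitarian welfare is $\mathsf{EW}(\mathbf A)=\min_{i\in N}v_i(A_i)$; $\mathsf{OPT}_E(\mathcal I)$ is the maximum of $\mathsf{EW}$ over all allocations of $\mathcal I$. An allocation $\mathbf A$ is PROP1 (proportional up to one item) if for every $i\in N$, either $v_i(A_i)\ge\frac1n v_i(E)$, or there is an item $e\in E\setminus A_i$ such that $A_i\cup\{e\}$ is connected and $v_i(A_i\cup\{e\})\ge\frac1n v_i(E)$. The price of fairness is $\mathrm{PoF}_n=\sup_{\mathcal I}\min_{\mathbf A}\frac{\mathsf{OPT}_E(\mathcal I)}{\mathsf{EW}(\mathbf A)}$, the supremum over all fair-goods instances with $n$ agents (any number of items) and the minimum over all PROP1 allocations $\mathbf A$ of $\mathcal I$;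 conventions: $c/0=+\infty$ for $c>0$ and $0/0=1$. *)

(* Defs.v *)
From HB Require Import structures.
From mathcomp Require Import all_boot all_order all_algebra.
From mathcomp Require Import classical_sets reals constructive_ereal ereal.

Set Implicit Arguments.
Unset Strict Implicit.
Unset Printing Implicit Defensive.

Import Order.TTheory GRing.Theory Num.Theory.

Local Open Scope ring_scope.

(* The path e_1, ..., e_m is 'I_m in its natural order. *)
Record instance (R : realType) (n : nat) := Instance {
  nitems : nat;
  item_value : 'I_n -> 'I_nitems -> R;
  item_value_ge0 : forall i e, 0 <= item_value i e;
  item_value_sum1 : forall i, \sum_(e < nitems) item_value i e = 1
}.

Definition value (R : realType) (n : nat) (I : instance R n)
    (i : 'I_n) (S : {set 'I_(nitems I)}) : R :=
  \sum_(e in S) item_value i e.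

Definition connected_bundle (m : nat) (S : {set 'I_m}) : bool :=
  [exists a : 'I_m.+1, exists b : 'I_m.+1,
    S == [set e : 'I_m | (a <= e < b)%N]%SET].

(* The bundle of agent i is A i; bundles may be empty. *)
Definition allocation (n m : nat) (A : {ffun 'I_n -> {set 'I_m}}) : bool :=
  [&& [forall i, forall j, (i != j) ==> [disjoint A i & A j]],
      (\bigcup_i A i)%SET == [set: 'I_m]%SET
    & [forall i, connected_bundle (A i)]].

Definition prop1 (R : realType) (n : nat) (I : instance R n)
    (A : {ffun 'I_n -> {set 'I_(nitems I)}}) : bool :=
  [forall i : 'I_n,
    (n%:R^-1 * value i [set: 'I_(nitems I)]%SET <= value i (A i)) ||
    [exists e : 'I_(nitems I),
      [&& e \notin A i, connected_bundle (e |: A i)%SET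
        & n%:R^-1 * value i [set: 'I_(nitems I)]%SET
            <= value i (e |: A i)%SET]]].

Local Open Scope ereal_scope.

Definition egal_welfare (R : realType) (n : nat) (I : instance R n)
    (A : {ffun 'I_n -> {set 'I_(nitems I)}}) : \bar R :=
  \big[mine/+oo]_(i < n) (value i (A i))%:E.

Definition opt_egal (R : realType) (n : nat) (I : instance R n) : \bar R :=
  \big[maxe/-oo]_(A : {ffun 'I_n -> {set 'I_(nitems I)}} | allocation A)
    egal_welfare A.

(* Since 0^-1 = +oo in \bar R, the library division already gives c / 0 = +oo
   for c > 0; only 0 / 0 (which would be 0) needs a separate case. *)
Definition welfare_ratio (R : realType) (x y : \bar R) : \bar R :=
  if (x == 0) && (y == 0) then 1 else x / y.

(* A PROP1 allocation always exists (round the cuts of a proportional division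
   of the path seen as an interval), so the default +oo is harmless. *)
Definition min_ratio_prop1 (R : realType) (n : nat) (I : instance R n)
    : \bar R :=
  \big[mine/+oo]_(A : {ffun 'I_n -> {set 'I_(nitems I)}}
                    | allocation A && prop1 A)
    welfare_ratio (opt_egal I) (egal_welfare A).

Definition PoF_prop1 (R : realType) (n : nat) : \bar R :=
  ereal_sup (range (@min_ratio_prop1 R n)).

(* Main.v *)
(* Take as many items as agents. Each agent other than the first and the last
   values only the item with its own index, while the first and the last agent
   both value the first item at eps = 1/(n+1) < 1/n and the last item at
   1 - eps. Giving item i to agent i has positive welfare. Conversely, if every
   agent gets positive value, then one of the two end agents owns the first item
   but not the last one, and the second item belongs to another agent; adding one
   item to its bundle while keeping it connected cannot bring in the last item,
   so its value stays at eps, and PROP1 fails. *)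
Require Import Defs.
From mathcomp Require Import all_boot all_order all_algebra.
From mathcomp Require Import classical_sets reals constructive_ereal ereal.

Set Implicit Arguments.
Unset Strict Implicit.
Unset Printing Implicit Defensive.

Import Order.TTheory GRing.Theory Num.Theory.

Local Open Scope ring_scope.

Lemma connected_bundle_convex (m : nat) (S : {set 'I_m}) (x y z : 'I_m) :
  connected_bundle S -> x \in S -> z \in S -> (x <= y <= z)%N -> y \in S.
Proof.
case/existsP => a /existsP[b /eqP->]; rewrite !inE.
move=> /andP[ax _] /andP[_ zb] /andP[xy yz].
by rewrite (leq_trans ax xy) (leq_ltn_trans yz zb).
Qed.

Lemma connected_bundle1 (m : nat) (x : 'I_m) : connected_bundle [set x]%SET.
Proof.
(* The singleton is the half-open interval from [x] to [x.+1]; the right end ranges over ['I_m.+1],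
   so the last item is covered too. *)
apply/existsP; exists (widen_ord (leqnSn m) x); apply/existsP.
exists (Ordinal (ltn_ord x : (x.+1 < m.+1)%N)).
by apply/eqP/setP => y; rewrite !inE /= ltnS -eqn_leq eq_sym.
Qed.

Lemma sum_indicator (R : pzSemiRingType) (T : finType) (S : {set T}) (a : T) :
  \sum_(e in S) (e == a)%:R = (a \in S)%:R :> R.
Proof.
case: (boolP (a \in S)) => aS.
  by rewrite (bigD1 a) //= eqxx big1 ?addr0 // => e /andP[_ /negbTE->].
by rewrite big1 // => e eS; case: eqP => // ea; rewrite -ea eS in aS.
Qed.

Section WelfareRatio.
Context {R : realType} {n : nat}.
Variable I : instance R n.
Implicit Type A : {ffun 'I_n -> {set 'I_(nitems I)}}.

Lemma value_ge0 (i : 'I_n) (S : {set 'I_(nitems I)}) : 0 <= value i S.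
Proof. by apply: sumr_ge0 => e _; apply: item_value_ge0. Qed.

Lemma value_setT (i : 'I_n) : value i [set: 'I_(nitems I)]%SET = 1.
Proof.
by rewrite -(item_value_sum1 I i) /value; apply: eq_bigl => e; rewrite inE.
Qed.

Lemma egal_welfare_eq0 A (i : 'I_n) :
  value i (A i) = 0 -> egal_welfare A = 0%E.
Proof.
move=> vi; apply/eqP; rewrite eq_le /egal_welfare; apply/andP; split.
  by rewrite (bigD1 i) //= vi ge_min lexx.
by apply/bigmin_geP; split => [|j _]; rewrite ?leey // lee_fin value_ge0.
Qed.

Lemma opt_egal_gt0 A :
  allocation A -> (forall i, 0 < value i (A i)) -> (0 < opt_egal I)%E.
Proof.
move=> allocA Apos; apply: (@lt_le_trans _ _ (egal_welfare A)).
  by apply/bigmin_gtP; split => [|j _]; rewrite ?ltey // lte_fin Apos.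
by rewrite /opt_egal (bigD1 A) //= le_max lexx.
Qed.

(** Every ratio in the minimum is positive over 0, hence infinite; positivity of the optimum rules
    out the case 0/0 = 1. *)
Lemma min_ratio_prop1_eqy :
  (0 < opt_egal I)%E ->
  (forall A, allocation A -> prop1 A -> exists i, value i (A i) = 0) ->
  min_ratio_prop1 I = +oo%E.
Proof.
move=> opt0 A0; apply/eqP; rewrite -leye_eq; apply/bigmin_geP.
split => // A /andP[allocA propA].
have [i /egal_welfare_eq0 ->] := A0 A allocA propA.
by rewrite /welfare_ratio gt_eqF //= inve0 gt0_muley.
Qed.

End WelfareRatio.

Section BadInstance.
Variables (R : realType) (k : nat).

Definition end_agent (i : 'I_k.+2) : bool := (i == ord0) || (i == ord_max).

Definition eps : R := k.+3%:R^-1.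

Definition bad_value (i e : 'I_k.+2) : R :=
  if end_agent i then eps * (e == ord0)%:R + (1 - eps) * (e == ord_max)%:R
  else (e == i)%:R.

Lemma eps_gt0 : 0 < eps.
Proof. by rewrite invr_gt0 ltr0n. Qed.

Lemma eps_lt : eps < k.+2%:R^-1.
Proof. by rewrite ltf_pV2 ?posrE ?ltr0n // ltr_nat. Qed.

Lemma eps_lt1 : eps < 1.
Proof. by rewrite invf_lt1 ?ltr0n // ltr1n. Qed.

Lemma bad_value_ge0 i e : 0 <= bad_value i e.
Proof.
rewrite /bad_value; case: ifP => _; last exact: ler0n.
by have := eps_gt0; have := eps_lt1 => e1 e0;
  rewrite addr_ge0 // mulr_ge0 ?ler0n ?subr_ge0 // ltW.
Qed.

Lemma sum_bad_value i (S : {set 'I_k.+2}) :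
  \sum_(e in S) bad_value i e =
  if end_agent i then eps * (ord0 \in S)%:R + (1 - eps) * (ord_max \in S)%:R
  else (i \in S)%:R.
Proof.
rewrite /bad_value; case: ifP => _; last exact: sum_indicator.
by rewrite big_split -!mulr_sumr !sum_indicator.
Qed.

Lemma bad_value_sum1 i : \sum_(e < k.+2) bad_value i e = 1.
Proof.
transitivity (\sum_(e in [set: 'I_k.+2]%SET) bad_value i e).
  by apply: eq_bigl => e; rewrite inE.
by rewrite sum_bad_value !inE; case: ifP => // _; rewrite !mulr1 subrKC.
Qed.

Definition bad_instance : instance R k.+2 :=
  Instance bad_value_ge0 bad_value_sum1.

Lemma bad_instance_value i (S : {set 'I_k.+2}) :
  @value R k.+2 bad_instance i S =
  if end_agent i then eps * (ord0 \in S)%:R + (1 - eps) * (ord_max \in S)%:R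
  else (i \in S)%:R.
Proof. exact: sum_bad_value. Qed.

(** Only the first item can still contribute, so the value is at most [eps]. This serves to refute
    PROP1 both for a bundle and for its extension by one item. *)
Lemma end_agent_value_lt i (S : {set 'I_k.+2}) :
  end_agent i -> ord_max \notin S ->
  @value R k.+2 bad_instance i S < k.+2%:R^-1.
Proof.
move=> endi /negbTE maxS; rewrite bad_instance_value endi maxS mulr0 addr0.
apply: le_lt_trans eps_lt; case: (_ \in _); rewrite ?mulr1 // mulr0.
exact/ltW/eps_gt0.
Qed.

Lemma bad_instance_opt_gt0 : (0 < opt_egal bad_instance)%E.
Proof.
apply: (@opt_egal_gt0 _ _ bad_instance [ffun i => [set i]%SET]); last first.
  move=> i; rewrite ffunE bad_instance_value !inE eqxx.
  have := eps_gt0; have := eps_lt1 => e1 e0.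
  rewrite /end_agent ![_ == i]eq_sym.
  (* The first agent gets [eps], the last [1 - eps], any other agent 1. *)
  case: eqP => [->|_] /=; first by rewrite mulr1 mulr0 addr0.
  by case: eqP => _ //=; rewrite mulr0 mulr1 add0r subr_gt0.
apply/and3P; split.
- apply/'forall_forallP => i j; apply/implyP => ij.
  by rewrite !ffunE disjoints1 inE.
- apply/eqP/setP => i; rewrite inE; apply/bigcupP; exists i => //.
  by rewrite ffunE inE.
- by apply/forallP => i; rewrite ffunE connected_bundle1.
Qed.

End BadInstance.

(** With [k.+3] items, item 1 lies strictly between the two ends, so the agent of the same index is
    not an end agent. *)
Lemma bad_instance_prop1 (R : realType) (k : nat)
    (A : {ffun 'I_k.+3 -> {set 'I_k.+3}}) :
  allocation A -> @prop1 R _ (bad_instance R k.+1) A ->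
  exists i, @value R _ (bad_instance R k.+1) i (A i) = 0.
Proof.
move=> /and3P[/'forall_forallP disjA _ _] /forallP propA.
apply/'exists_eqP; apply: contraT; rewrite negb_exists => /forallP Apos.
have owner i j e : i != j -> e \in A i -> e \notin A j.
  by move=> ij; apply: contraL => ej; have /implyP/(_ ij) := disjA i j;
    rewrite disjoint_sym => /disjointFr ->.
(* The last item cannot belong to both end agents. *)
have [s ends maxs] : exists2 s, end_agent s & ord_max \notin A s.
  case: (boolP (ord_max \in A ord0)) => [max0|]; last by exists ord0.
  by exists ord_max; [rewrite /end_agent eqxx orbT | apply: owner max0].
(* Without the last item, a nonzero value can only come from the first. *)
have zero_s : ord0 \in A s.
  have := Apos s; rewrite bad_instance_value ends (negbTE maxs) mulr0 addr0.
  by case: (_ \in _); rewrite // mulr0 eqxx.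
pose one : 'I_k.+3 := Ordinal (isT : (1 < k.+3)%N).
have one_one : one \in A one.
  have := Apos one; rewrite bad_instance_value (_ : end_agent one = false) //.
  by case: (_ \in _); rewrite // eqxx.
have one_s : one \notin A s.
  by apply: owner one_one; apply/eqP => ones; move: ends; rewrite -ones.
(* The bundle of [s] is worth less than 1/n, so PROP1 must supply an item [e]; by the same bound,
   [e] has to be the last item. *)
have := propA s; rewrite value_setT mulr1.
rewrite leNgt end_agent_value_lt //= => /existsP[e /and3P[_ conn]].
case: (boolP (ord_max \in (e |: A s)%SET)) => [maxe _|maxe]; last first.
  by rewrite leNgt end_agent_value_lt.
have ee : e = ord_max.
  by move: maxe; rewrite !inE (negbTE maxs) orbF => /eqP.
(* Convexity forces [one] into the extended bundle, yet it is neither in [A s] nor equal to [e]. *)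
have := connected_bundle_convex (x := ord0) (y := one) conn _ maxe.
by rewrite !inE zero_s orbT (negbTE one_s) orbF ee => /(_ isT isT).
Qed.

Theorem theorem17 (R : realType) (n : nat) (hn : (3 <= n)%N) :
  PoF_prop1 R n = +oo%E.
Proof.
case: n hn => [|[|[|k]]] // _.
apply/eqP; rewrite -leye_eq /PoF_prop1.
(* A single instance already attains the infinite supremum; [k.+1] matches n = [k.+3]. *)
rewrite -(min_ratio_prop1_eqy (bad_instance_opt_gt0 R k.+1)
                              (@bad_instance_prop1 R k)).
by apply: ereal_sup_ubound; exists (bad_instance R k.+1).
Qed.
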